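(* Let $a>0$ and $b>0$, let $n\ge1$ be an integer, and let a society consist of $n$ egoists, the utility increments in a random proposal being independent random variables with the continuous uniform distribution on the segment $[-a,b]$. Then $$\alpha_0=\left(1+\frac{b}{a}\right)^{-1}$$ is an optimal majority/acceptance threshold, i.e. $\mathrm{E}(\eta_i(\alpha_0))\ge \mathrm{E}(\eta_i(\alpha))$ for every $\alpha\in[-\frac1n,1]$ and every $i\in\{1,\dots,n\}$.
   Context: Setting (ViSE model, society of $n$ egoists): a random proposal is a vector $\boldsymbol\zeta=(\zeta_1,\ldots,\zeta_n)$ of independent identically distributed real random variables; $\zeta_i$ is the proposed utility increment of agent $i$. Each agent votes for the proposal if and only if his/her own proposed increment is positive. For a relative voting threshold $\alpha\in[-\frac1n,1]$, the proposal is accepted if and only if $\#\{k:\zeta_k>0,\ k=1,\ldots,n\}>\alpha n$. The actual utility increments are $\eta_i(\alpha)=\zeta_i\, I(\boldsymbol\zeta,\alpha n)$, where $I(\boldsymbol\zeta,\alpha n)=1$ if $\#\{k:\zeta_k>0\}>\alpha n$ and $I(\boldsymbol\zeta,\alpha n)=0$ otherwise. A threshold in $[-\frac1n,1]$ is called optimal if it provides the highest possible expected utility increment $\mathrm{E}(\eta_i(\alpha))$ of an agent (this expectation does not depend on $i$); optimal thresholds are not unique. *)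

(* Defs.v *)
From mathcomp Require Import all_boot all_order all_algebra.
From mathcomp Require Import all_classical all_reals all_analysis.

Set Implicit Arguments.
Unset Strict Implicit.
Unset Printing Implicit Defensive.

Import Order.TTheory GRing.Theory Num.Theory.

Local Open Scope classical_set_scope.
Local Open Scope ring_scope.

(* Independence of the whole family: product rule over every subfamily. *)
Definition mutually_independent (d : measure_display) (T : measurableType d)
    (R : realType) (P : probability T R) (n : nat)
    (X : 'I_n -> {RV P >-> R}) : Prop :=
  forall (J : {set 'I_n}) (A : 'I_n -> set R),
    (forall i, measurable (A i)) ->
    P (\bigcap_(i in [set` J]) (X i @^-1` A i)) =
    (\prod_(i in J) P (X i @^-1` A i))%E.

(* The library's [uniform_prob] takes a proof that its interval is
   nondegenerate. *)
Lemma ltNr_gt0 (R : realType) (a b : R) : 0 < a -> 0 < b -> - a < b.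
Proof. by move=> a0 b0; apply: lt_trans b0; rewrite oppr_lt0. Qed.

(* Equality of laws is required on Borel sets only: outside the measurable
   sets both sides carry no probabilistic meaning. *)
Definition uniformly_distributed (d : measure_display) (T : measurableType d)
    (R : realType) (P : probability T R) (X : {RV P >-> R})
    (l u : R) (lu : l < u) : Prop :=
  forall A : set R, measurable A -> distribution P X A = uniform_prob lu A.

Definition votes_for (R : realType) (n : nat) (z : 'I_n -> R) : nat :=
  #|[pred k : 'I_n | 0 < z k]|.

(* [t] is the absolute threshold, i.e. alpha * n for a relative threshold
   alpha; acceptance is by strict inequality. *)
Definition acceptance (R : realType) (n : nat) (z : 'I_n -> R) (t : R) : R :=
  if t < (votes_for z)%:R then 1 else 0.

Definition actual_increment (d : measure_display) (T : measurableType d)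
    (R : realType) (P : probability T R) (n : nat)
    (zeta : 'I_n -> {RV P >-> R}) (alpha : R) (i : 'I_n) : T -> R :=
  fun w => zeta i w * acceptance (fun k => zeta k w) (alpha * n%:R).

Definition admissible_threshold (R : realType) (n : nat) (alpha : R) : Prop :=
  - n%:R^-1 <= alpha <= 1.

Definition optimal_threshold (d : measure_display) (T : measurableType d)
    (R : realType) (P : probability T R) (n : nat)
    (zeta : 'I_n -> {RV P >-> R}) (alpha0 : R) : Prop :=
  admissible_threshold n alpha0 /\
  forall (i : 'I_n) (alpha : R), admissible_threshold n alpha ->
    ('E_P[actual_increment zeta alpha i] <=
     'E_P[actual_increment zeta alpha0 i])%E.

(* Main.v *)
Require Import Defs.
From mathcomp Require Import all_boot all_order all_algebra.
From mathcomp Require Import all_classical all_reals all_analysis.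
From mathcomp Require Import measurable_realfun perm ring.

Set Implicit Arguments.
Unset Strict Implicit.
Unset Printing Implicit Defensive.

Import Order.TTheory GRing.Theory Num.Theory.
Import numFieldNormedType.Exports.

Local Open Scope classical_set_scope.
Local Open Scope ring_scope.

(** Whether a proposal is accepted depends only on the set [J] of agents whose
increment is positive. Conditionally on [J], independence leaves each
coordinate uniform on its own half of the segment: the mean of the increment
of agent [i] is [b / 2] when [i] is in [J] and [- a / 2] otherwise. Hence
the expected actual increment at threshold [alpha] is the finite sum
[[
  \sum_(J | alpha * n < #|J|) P(J) * (if i \in J then b / 2 else - a / 2)
]]
which is [expectation_actual_increment].

The probability [P(J)] depends on [J] through its cardinality only, so the sum
is the same for all agents ([symmetrise_pattern_sum]) and [n] times it equals
the total over the agents,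
[[
  \sum_(J | alpha * n < #|J|) P(J) * (#|J| * (a + b) - n * a) / 2.
]]
A coalition [J] contributes a positive amount exactly when
[#|J| > n * a / (a + b)], that is, when it is accepted at the threshold
[(1 + b / a)^-1 = a / (a + b)]. This threshold therefore keeps all the positive
terms and drops all the others, and no other choice of terms can do better
([pattern_sum_maximal]).

The conditional means come from [integral_supported_by], which factors the
integral of one coordinate over a product event: the remaining coordinates
contribute the probability of their own event
([ge0_integral_independent_box]). *)

(** * Integration over events independent of a random variable *)

(** Restricting [P] to [D] and pushing the result forward along [X] yields, by
the independence hypothesis, the law of [X] scaled by [P D]; the identity is
then the change of variables formula. *)
Lemma ge0_integral_indep_event (d : measure_display) (T : measurableType d)
    (R : realType) (P : probability T R) (X : {RV P >-> R}) (D : set T)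
    (h : R -> \bar R) (C : set R) :
  measurable D ->
  (forall A, measurable A ->
     P (X @^-1` A `&` D) = (P D * P (X @^-1` A))%E) ->
  measurable C -> measurable_fun C h -> (forall x, C x -> 0 <= h x)%E ->
  (\int[P]_(w in X @^-1` C `&` D) h (X w) =
   P D * \int[distribution P X]_(x in C) h x)%E.
Proof.
move=> mD indep mC mh h0.
have mX : measurable_fun setT X by [].
have mXC : measurable (X @^-1` C) by rewrite -[X in measurable X]setTI; exact: mX.
have mhX : measurable_fun (X @^-1` C) (h \o X).
  by apply: (measurable_comp mC) => //; [move=> _ [w Cw <-] | exact: measurable_funTS].
have PD0 : 0 <= fine (P D) by rewrite fine_ge0.
(* On subsets of [D] the measure [P] agrees with its restriction to [D], and
   that restriction does not see what lies outside [D]. *)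
transitivity (\int[mrestr P mD]_(w in X @^-1` C `&` D) h (X w))%E.
  apply: eq_measure_integral => A mA AD.
  by rewrite /= /mrestr setIidl// => w /AD[].
transitivity (\int[mrestr P mD]_(w in X @^-1` C) h (X w))%E.
  rewrite [RHS](@ge0_negligible_integral _ _ _ _ _ (~` D))//.
  - by rewrite setDE setCK.
  - exact: measurableC.
  - by move=> w; exact: h0.
  - by rewrite /= /mrestr setICl measure0.
transitivity (\int[mscale (NngNum PD0) (distribution P X)]_(x in C) h x)%E.
  transitivity (\int[pushforward (mrestr P mD) X]_(x in C) h x)%E.
    rewrite (ge0_integral_pushforward mX)//.
    by move=> x; rewrite inE; exact: h0.
  apply: eq_measure_integral => A mA _.
  by rewrite /= /pushforward /mrestr /mscale/= indep// fineK ?fin_num_measure.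
by rewrite ge0_integral_mscale//= fineK// fin_num_measure.
Qed.

(** Mutual independence makes coordinate [i] independent of the event [D]
formed by the constraints on the other coordinates: constraining coordinate
[i] to an arbitrary [B] merely replaces one factor of the product. *)
Lemma ge0_integral_independent_box (d : measure_display) (T : measurableType d)
    (R : realType) (P : probability T R) (n : nat) (X : 'I_n -> {RV P >-> R})
    (A : 'I_n -> set R) (i : 'I_n) (h : R -> \bar R) :
  mutually_independent X -> (forall k, measurable (A k)) ->
  measurable_fun (A i) h -> (forall x, A i x -> 0 <= h x)%E ->
  (\int[P]_(w in \bigcap_k (X k @^-1` A k)) h (X i w) =
   \prod_(k | k != i) P (X k @^-1` A k) *
     \int[distribution P (X i)]_(x in A i) h x)%E.
Proof.
move=> indep mA mh h0.
set D := \bigcap_(k in [set` [set~ i]%SET]) (X k @^-1` A k).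
have splitE (B : set R) : X i @^-1` B `&` D =
    \bigcap_(k in [set` [set: 'I_n]%SET])
      (X k @^-1` (if k == i then B else A k)).
  apply/seteqP; split => w.
    move=> [Bw Dw] k _; case: eqP => [->//|/eqP ki].
    by apply: Dw; rewrite /= !inE.
  move=> Hw; split; first by have := Hw i; rewrite eqxx; apply; rewrite /= inE.
  move=> k; rewrite /= !inE => ki.
  by have := Hw k; rewrite (negbTE ki); apply; rewrite /= inE.
have PD : (P D = \prod_(k | k != i) P (X k @^-1` A k))%E.
  by rewrite indep//; apply: eq_bigl => k; rewrite !inE.
have -> : \bigcap_k (X k @^-1` A k) = X i @^-1` A i `&` D.
  rewrite splitE; apply/seteqP; split => w Hw k _.
    by case: eqP => [<-|_]; exact: Hw.
  by have := Hw k; case: eqP => [->|_]; apply; rewrite /= inE.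
have mD : measurable D.
  apply: fin_bigcap_measurable => // k _.
  by rewrite -[X in measurable X]setTI; exact: measurable_funPT.
rewrite (ge0_integral_indep_event mD)//; first by rewrite PD.
move=> B mB; rewrite splitE indep; last by move=> k; case: ifP.
rewrite PD (bigD1 i) ?inE//= eqxx muleC; congr (_ * _)%E.
by apply: eq_big => [k|k /andP[_ /negbTE ->]]; rewrite ?inE.
Qed.

(** * Uniform law on a segment straddling the origin *)

Lemma integral_uniform_in (R : realType) (l u : R) (lu : l < u) (C : set R)
    (f : R -> \bar R) :
  measurable C -> measurable_fun C f -> (forall x, C x -> 0 <= f x)%E ->
  (\int[uniform_prob lu]_(x in C) f x =
   (u - l)^-1%:E * \int[lebesgue_measure]_(x in C `&` `[l, u]) f x)%E.
Proof.
move=> mC mf f0; rewrite integral_mkcond integral_uniform.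
- by congr (_ * _)%E; rewrite setIC [RHS]integral_mkcondr.
- exact/(measurable_restrictT _ mC).
- by move=> x; rewrite patchE; case: ifPn => // /set_mem/f0.
Qed.

(** The two measures agree on every Borel set, but the uniform law lives on the
real line generated by half-open intervals, which is another structure with the
same measurable sets; the push-forward along the identity carries it over. *)
Lemma integral_uniformly_distributed (d : measure_display) (T : measurableType d)
    (R : realType) (P : probability T R) (X : {RV P >-> R}) (l u : R)
    (lu : l < u) (C : set R) (h : R -> \bar R) :
  uniformly_distributed X lu ->
  measurable C -> measurable_fun C h -> (forall x, C x -> 0 <= h x)%E ->
  (\int[distribution P X]_(x in C) h x = \int[uniform_prob lu]_(x in C) h x)%E.
Proof.
move=> XU mC mh h0.
pose id_borel : measurableTypeR R -> R := fun x => x.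
have mid_borel : measurable_fun setT id_borel by move=> _ B mB; rewrite setTI.
transitivity (\int[pushforward (uniform_prob lu) id_borel]_(x in C) h x)%E.
  by apply: eq_measure_integral => B mB _; exact: XU.
rewrite (ge0_integral_pushforward mid_borel)// => x.
by rewrite inE; exact: h0.
Qed.

Lemma integral_linear (R : realType) (c l u : R) : l < u ->
  (\int[lebesgue_measure]_(x in `[l, u]) (c * x)%:E =
   (c * (u ^+ 2 - l ^+ 2) / 2)%:E)%E.
Proof.
move=> lu.
have dF (x : R) : is_derive x 1 (fun y : R => c * y ^+ 2 / 2) (c * x).
  by apply: is_derive_eq; rewrite /GRing.scale/=; field.
have cF : continuous (fun y : R => c * y ^+ 2 / 2).
  by move=> x; apply/differentiable_continuous/derivable1_diffP.
rewrite (@continuous_FTC2 _ (fun x => c * x) (fun x => c * x ^+ 2 / 2))//.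
- by rewrite -EFinB; congr EFin; field.
- by apply: continuous_subspaceT => y; apply: cvgMr; exact: cvg_id.
- split.
  + by move=> x _.
  + by apply: cvg_at_right_filter; exact: cF.
  + by apply: cvg_at_left_filter; exact: cF.
- by move=> x _; rewrite derive1E; apply: derive_val.
Qed.

(** The sign classes that decide a vote, the origin going with the rejections.
Indexing them by a boolean lets one formula serve supporters and opponents. *)
Definition half_line (R : realType) (s : bool) : set R :=
  [set x | (0 < x) = s].
Arguments half_line : clear implicits.

Lemma half_lineE (R : realType) (s : bool) :
  half_line R s = [set` if s then `]0, +oo[ else `]-oo, 0]].
Proof.
apply/seteqP; case: s; split => x; rewrite /half_line/= in_itv/= ?andbT//.
- by rewrite leNgt => ->.
- by rewrite leNgt => /negbTE.
Qed.

Lemma measurable_half_line (R : realType) (s : bool) :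
  measurable (half_line R s).
Proof. by rewrite half_lineE; case: s; exact: measurable_itv. Qed.

Section uniform_half_lines.
Context (R : realType) (a b : R) (ha : 0 < a) (hb : 0 < b).
Local Notation U := (uniform_prob (ltNr_gt0 ha hb)).

Let half_lineI s : half_line R s `&` `[- a, b] =
  [set` if s then `]0, b] else `[- a, 0]].
Proof.
apply/seteqP; case: s; split => x; rewrite /half_line/= !in_itv/=.
- by move=> [-> /andP[_ ->]].
- move=> /andP[x0 ->]; split => //; rewrite andbT.
  by rewrite ltW// (lt_trans _ x0)// oppr_lt0.
- by move=> [x0 /andP[-> _]]; rewrite leNgt x0.
- by move=> /andP[-> x0]; split; [rewrite ltNge x0 | rewrite (le_trans x0)// ltW].
Qed.

Lemma uniform_half_line s :
  U (half_line R s) = ((if s then b else a) / (a + b))%:E.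
Proof.
have mS := @measurable_half_line R s.
rewrite -[LHS]mul1e -integral_cst// integral_uniform_in// integral_cst; last first.
  by rewrite half_lineI; case: s {mS}; exact: measurable_itv.
rewrite mul1e half_lineI opprK [b + a]addrC mulrC EFinM; congr (_ * _)%E.
case: s {mS}.
- by rewrite [LHS]lebesgue_measure_itv/= lte_fin hb -EFinB subr0.
- by rewrite [LHS]lebesgue_measure_itv/= lte_fin oppr_lt0 ha -EFinB sub0r opprK.
Qed.

(** Conditioned on either half-line, the uniform law is uniform on the
segment from the origin to an end point, so the mean distance to the origin is
half the length of that segment. *)
Lemma integral_uniform_half_line s :
  (\int[U]_(x in half_line R s) `|x|%:E =
   U (half_line R s) * ((if s then b else a) / 2)%:E)%E.
Proof.
have ab0 : a + b != 0 by rewrite gt_eqF// addr_gt0.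
rewrite uniform_half_line integral_uniform_in//; last 2 first.
  exact: measurable_half_line.
  by apply/measurable_EFinP/measurable_funTS; exact: normr_measurable.
rewrite half_lineI; case: s.
  rewrite integral_itv_obnd_cbnd; last first.
    by apply/measurable_EFinP/measurable_funTS; exact: normr_measurable.
  transitivity ((b - - a)^-1%:E *
      \int[lebesgue_measure]_(x in `[0%R, b]) (1 * x)%:E)%E.
    congr (_ * _)%E; apply: eq_integral => x; rewrite inE/= in_itv/=.
    by move=> /andP[x0 _]; rewrite mul1r ger0_norm.
  by rewrite integral_linear// -!EFinM; congr EFin; rewrite opprK [b + a]addrC; field.
transitivity ((b - - a)^-1%:E *
    \int[lebesgue_measure]_(x in `[(- a)%R, 0%R]) (- 1 * x)%:E)%E.
  congr (_ * _)%E; apply: eq_integral => x; rewrite inE/= in_itv/=.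
  by move=> /andP[_ x0]; rewrite mulN1r ler0_norm.
by rewrite integral_linear ?oppr_lt0// -!EFinM; congr EFin; rewrite opprK [b + a]addrC; field.
Qed.

End uniform_half_lines.

(** * Expected increment as a sum over coalitions of supporters *)

Definition supporters (R : realType) (n : nat) (z : 'I_n -> R) : {set 'I_n} :=
  [set k | 0 < z k]%SET.

Section society.
Context (R : realType) (d : measure_display) (T : measurableType d).
Context (P : probability T R) (a b : R) (ha : 0 < a) (hb : 0 < b) (n : nat).
Context (zeta : 'I_n -> {RV P >-> R}).
Hypothesis zeta_indep : mutually_independent zeta.
Hypothesis zeta_unif : forall i : 'I_n,
  uniformly_distributed (zeta i) (ltNr_gt0 ha hb).

Definition supported_by (J : {set 'I_n}) : set T :=
  [set w | supporters (fun k => zeta k w) = J].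

Lemma supported_byE J :
  supported_by J = \bigcap_k (zeta k @^-1` half_line R (k \in J)).
Proof.
apply/seteqP; split => w; rewrite /supported_by/half_line/=.
  by move=> <- k _ /=; rewrite inE.
by move=> Hw; apply/setP => k; rewrite inE (Hw k I).
Qed.

Lemma measurable_supported_by J : measurable (supported_by J).
Proof.
rewrite supported_byE; apply: fin_bigcap_measurable => // k _.
rewrite -[X in measurable X]setTI; apply: measurable_funPT => //.
exact: measurable_half_line.
Qed.

(** Given the coalition, the increment of agent [i] has a known sign, so it is
its absolute value up to that sign and the integral formulas for nonnegative
functions apply. *)
Lemma integral_supported_by i J :
  (\int[P]_(w in supported_by J) (zeta i w)%:E =
   ((\prod_k ((if k \in J then b else a) / (a + b))) *
     ((if i \in J then b else - a) / 2))%:E)%E.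
Proof.
have lawE k s : P (zeta k @^-1` half_line R s) =
    ((if s then b else a) / (a + b))%:E.
  rewrite -(uniform_half_line ha hb) -(zeta_unif k)//.
  exact: measurable_half_line.
have absE : (\int[P]_(w in supported_by J) `|zeta i w|%:E =
    ((\prod_k ((if k \in J then b else a) / (a + b))) *
      ((if i \in J then b else a) / 2))%:E)%E.
  rewrite supported_byE (@ge0_integral_independent_box _ _ _ _ _ _ _ i
    (fun x => `|x|%:E) zeta_indep)//; last 2 first.
  - by move=> k; exact: measurable_half_line.
  - by apply/measurable_EFinP/measurable_funTS; exact: normr_measurable.
  rewrite (integral_uniformly_distributed (zeta_unif i))//; last 2 first.
  - exact: measurable_half_line.
  - by apply/measurable_EFinP/measurable_funTS; exact: normr_measurable.
  rewrite integral_uniform_half_line uniform_half_line muleA [RHS]EFinM.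
  congr (_ * _)%E; rewrite [in RHS](bigD1 i)//= [RHS]EFinM muleC; congr (_ * _)%E.
  rewrite -prodEFin; apply: eq_bigr => k _; exact: lawE.
case: (boolP (i \in J)) absE => iJ absE.
  rewrite -absE; apply: eq_integral => w; rewrite inE => Jw; rewrite ger0_norm//.
  by move: iJ; rewrite -Jw inE; exact: ltW.
rewrite mulNr mulrN EFinN -absE -integral_ge0N//.
apply: eq_integral => w; rewrite inE => Jw; rewrite ler0_norm ?EFinN ?oppeK//.
by move: iJ; rewrite -Jw inE leNgt.
Qed.

(** The events [supported_by J] partition the sample space, and the decision
is constant on each of them. *)
Lemma expectation_actual_increment alpha i :
  ('E_P[actual_increment zeta alpha i] =
   (\sum_(J : {set 'I_n} | (alpha * n%:R < #|J|%:R)%R)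
     (\prod_k ((if k \in J then b else a) / (a + b))) *
       ((if i \in J then b else - a) / 2))%:E)%E.
Proof.
have coverE : setT = \big[setU/set0]_(J : {set 'I_n}) supported_by J.
  rewrite -bigcup_seq; apply/seteqP; split => // w _.
  by exists (supporters (fun k => zeta k w)) => //=; rewrite mem_index_enum.
have acceptE J w : supported_by J w ->
    acceptance (fun k => zeta k w) (alpha * n%:R) =
    (if alpha * n%:R < #|J|%:R then 1 else 0).
  by move=> <-; rewrite /acceptance /votes_for /supporters cardsE.
have mI : measurable_fun setT (EFin \o actual_increment zeta alpha i).
  apply/measurable_EFinP; apply: measurable_funM => //.
  rewrite [X in measurable_fun _ X](_ : _ = fun w => \sum_(J : {set 'I_n})
      (if alpha * n%:R < #|J|%:R then 1 else 0) * \1_(supported_by J) w).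
    apply: measurable_sum => J; apply: measurable_funM => //.
    exact/measurable_indic/measurable_supported_by.
  apply/funext => w; pose S := supporters (fun k => zeta k w).
  rewrite (bigD1 S)//= big1 ?addr0 => [|J JS].
    by rewrite indicE mem_set// mulr1; exact: acceptE.
  rewrite indicE memNset ?mulr0// => SJ.
  by rewrite -SJ eqxx in JS.
rewrite unlock coverE integral_bigsetU_EFin; last 4 first.
- exact: measurable_supported_by.
- exact: index_enum_uniq.
- exact: trivIset_preimage1.
- by rewrite -coverE.
rewrite -sumEFin [RHS]big_mkcond/=; apply: eq_bigr => J _; case: ifP => tJ.
  rewrite -integral_supported_by; apply: eq_integral => w; rewrite inE => Jw.
  by rewrite /actual_increment (acceptE _ _ Jw) tJ mulr1.
apply: integral0_eq => w Jw.
by rewrite /actual_increment (acceptE _ _ Jw) tJ mulr0.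
Qed.

End society.

(** * Comparison of thresholds *)

Section optimum.
Context (R : realFieldType) (a b : R) (ha : 0 < a) (hb : 0 < b) (n : nat).

Let pattern_prob (J : {set 'I_n}) : R :=
  \prod_k ((if k \in J then b else a) / (a + b)).

Lemma pattern_probE J :
  pattern_prob J = (b / (a + b)) ^+ #|J| * (a / (a + b)) ^+ (n - #|J|).
Proof.
rewrite /pattern_prob (bigID (fun k => k \in J))/=; congr (_ * _).
  by rewrite (eq_bigr (fun=> b / (a + b))) ?prodr_const// => k ->.
rewrite (eq_bigr (fun=> a / (a + b))); last by move=> k /negbTE ->.
have -> : (n - #|J|)%N = #|~: J| by rewrite [RHS]cardsCs finset.setCK card_ord.
by rewrite -prodr_const; apply: eq_bigl => k; rewrite inE.
Qed.

(** Exchanging the agents [i] and [j] permutes the coalitions and preserves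
their size, hence their probability and whether they are accepted. *)
Lemma symmetrise_pattern_sum (u : R) (i j : 'I_n) :
  \sum_(J : {set 'I_n} | u < #|J|%:R)
     pattern_prob J * ((if i \in J then b else - a) / 2) =
  \sum_(J : {set 'I_n} | u < #|J|%:R)
     pattern_prob J * ((if j \in J then b else - a) / 2).
Proof.
have inj : injective (fun J : {set 'I_n} => [set tperm i j k | k in J]%SET).
  exact/imset_inj/perm_inj.
rewrite (reindex_inj inj)/=; apply: eq_big => J.
  by rewrite card_imset//; exact: perm_inj.
move=> _; rewrite !pattern_probE card_imset; last exact: perm_inj.
by rewrite -{1}(tpermR i j) (mem_imset _ _ (@perm_inj _ _)).
Qed.

(** Multiplied by [n], each sum becomes a total over the agents in which the
sign of a term depends only on the size of the coalition. The threshold on the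
right selects exactly the coalitions with a positive term. *)
Lemma pattern_sum_maximal (u : R) (i : 'I_n) :
  \sum_(J : {set 'I_n} | u < #|J|%:R)
     pattern_prob J * ((if i \in J then b else - a) / 2) <=
  \sum_(J : {set 'I_n} | (1 + b / a)^-1 * n%:R < #|J|%:R)
     pattern_prob J * ((if i \in J then b else - a) / 2).
Proof.
have n0 : 0 < n%:R :> R by rewrite ltr0n (leq_ltn_trans _ (ltn_ord i)).
have sumE (v : R) : n%:R * \sum_(J : {set 'I_n} | v < #|J|%:R)
     pattern_prob J * ((if i \in J then b else - a) / 2) =
   \sum_(J : {set 'I_n} | v < #|J|%:R)
     pattern_prob J * ((#|J|%:R * (a + b) - n%:R * a) / 2).
  rewrite mulr_natl -[X in _ *+ X](card_ord n) -sumr_const.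
  rewrite (eq_bigr (fun j => \sum_(J : {set 'I_n} | v < #|J|%:R)
      pattern_prob J * ((if j \in J then b else - a) / 2))); last first.
    by move=> j _; exact: symmetrise_pattern_sum.
  rewrite exchange_big/=; apply: eq_bigr => J _; rewrite -mulr_sumr.
  congr (_ * _); rewrite -mulr_suml; congr (_ / _).
  rewrite (eq_bigr (fun j => (if j \in J then a + b else 0) - a)); last first.
    by move=> j _; case: ifP => _; rewrite ?sub0r// addrAC subrr add0r.
  rewrite sumrB sumr_const card_ord -big_mkcond/= !mulr_natl.
  by rewrite sumr_const.
rewrite -(ler_pM2l n0) !sumE [leLHS]big_mkcond [leRHS]big_mkcond/=.
apply: ler_sum => J _.
have p0 : 0 <= pattern_prob J.
  apply: prodr_ge0 => k _; rewrite divr_ge0//.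
    by case: ifP => _; exact: ltW.
  by rewrite ltW// addr_gt0.
have -> : ((1 + b / a)^-1 * n%:R < #|J|%:R) =
    (0 < #|J|%:R * (a + b) - n%:R * a).
  have -> : (1 + b / a)^-1 = a / (a + b) by field; rewrite !gt_eqF ?addr_gt0.
  by rewrite mulrAC ltr_pdivrMr ?(addr_gt0 ha hb)// subr_gt0 [a * _]mulrC.
case: (ltP 0 (_ - _)) => [gain|loss]; case: ifP => // _.
  by rewrite mulr_ge0// divr_ge0// ltW.
by rewrite mulr_ge0_le0// pmulr_lle0.
Qed.

End optimum.

Theorem corollary2 (R : realType) (d : measure_display) (T : measurableType d)
    (P : probability T R) (a b : R) (ha : 0 < a) (hb : 0 < b)
    (n : nat) (hn : (1 <= n)%N) (zeta : 'I_n -> {RV P >-> R})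
    (zeta_indep : mutually_independent zeta)
    (zeta_unif : forall i : 'I_n,
        uniformly_distributed (zeta i) (ltNr_gt0 ha hb)) :
  optimal_threshold zeta (1 + b / a)^-1.
Proof.
split=> [|i alpha _].
  have ba0 : 0 < b / a by rewrite divr_gt0.
  apply/andP; split; last by rewrite invf_le1 ?addr_gt0// lerDl ltW.
  by rewrite (@le_trans _ _ 0)// ?oppr_le0 invr_ge0// addr_ge0// ltW.
rewrite !(expectation_actual_increment zeta_indep zeta_unif) lee_fin.
exact: pattern_sum_maximal.
Qed.
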